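(* The maximization problem $$\text{(QAP)}\qquad \max\Bigl\{\sum_{i\in M^+}\alpha_i R_i(\boldsymbol{x}_i)\ :\ \boldsymbol{x}_0\ge \boldsymbol{x}_i\ \ (i\in M),\quad \boldsymbol{x}_i\in\mathcal{F}_i\ \ (i\in M^+)\Bigr\}$$ has the same optimal objective value as the maximization problem (QAP-Rlx), in the variables $\boldsymbol{x}_0\in\mathbb{R}^n$ and $(y_{i0},\boldsymbol{y}_i)\in\mathbb{R}^{n+1}$, $i\in M^+$: $$\begin{aligned}\text{(QAP-Rlx)}\qquad \max\quad & \sum_{i\in M^+}\alpha_i\sum_{j\in N} r_{ij}u_{ij}y_{ij}\\ \text{s.t.}\quad & (y_{i0},\boldsymbol{y}_i)\in \operatorname{conv}\bigl(\Pi_i(\mathcal{F}_i)\bigr)\quad \text{for } i\in M,\\ & \boldsymbol{y}_0=y_{00}\boldsymbol{x}_0\ \text{ and }\ (y_{00},\boldsymbol{y}_0)\in\Pi_0(\mathcal{F}_0),\\ & \boldsymbol{y}_i\le y_{i0}\boldsymbol{x}_0\quad\text{for } i\in M.\end{aligned}$$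
   Context: $N=\{1,\dots,n\}$ is the set of products, $M=\{1,\dots,m\}$ the set of online consumer types, $0$ is the offline consumer type, and $M^+=\{0\}\cup M$. For $i\in M^+$: $\alpha_i\ge 0$ is the arrival probability of type $i$, with $\sum_{i\in M^+}\alpha_i=1$; $r_{ij}\in\mathbb{R}$ is the revenue from selling product $j\in N$ to type $i$; $u_{ij}\ge 0$ is the preference weight of type $i$ on product $j\in N$, and $u_{i0}>0$ is its preference weight on the no-purchase option. The set $\mathcal{F}_i\subseteq\{0,1\}^n$ is the set of feasible assortments for type $i$. Vector inequalities are componentwise. The expected revenue from type $i$ under assortment $\boldsymbol{x}_i=(x_{i1},\dots,x_{in})\in\{0,1\}^n$ is $$R_i(\boldsymbol{x}_i)=\frac{\sum_{j\in N} r_{ij}u_{ij}x_{ij}}{u_{i0}+\sum_{j\in N}u_{ij}x_{ij}}.$$ For $i\in M^+$, the choice probability set is $$\Pi_i(\mathcal{F}_i)=\Bigl\{(y_{i0},\boldsymbol{y}_i)\in\mathbb{R}^{n+1}: u_{i0}y_{i0}+\sum_{j\in N}u_{ij}y_{ij}=1,\ \boldsymbol{y}_i\in y_{i0}\cdot\mathcal{F}_i,\ y_{i0}>0\Bigr\},$$ where $\lambda\cdot S=\{\lambda \boldsymbol{x}:\boldsymbol{x}\in S\}$. $\operatorname{conv}$ denotes convex hull. A maximum over an empty set is $-\infty$. *)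

(* Defs.v *)
From mathcomp Require Import all_boot all_order all_algebra.
From mathcomp Require Import boolp classical_sets reals constructive_ereal convex.

Set Implicit Arguments.
Unset Strict Implicit.
Unset Printing Implicit Defensive.

Import Order.TTheory GRing.Theory Num.Theory.

Local Open Scope classical_set_scope.
Local Open Scope ring_scope.

(* Consumer types are indexed by 'I_m.+1: ord0 is the offline type and the
   i != ord0 are the m online types.  Product j is j : 'I_n, a vector of R^n is
   a row vector, and a point (y_0, y) of R^(n+1) is a pair; R^o carries the
   scalar multiplication that makes the pairs an lmodType. *)

Section Generic.
Context {R : realType}.

Definition vec_le (n : nat) (x y : 'rV[R]_n) : Prop :=
  forall j, x 0 j <= y 0 j.

Definition conv_hull (V : lmodType R) (A : set V) : set V :=
  smallest (@convex_set R V) A.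

Definition dilate (n : nat) (lambda : R) (S : set 'rV[R]_n) : set 'rV[R]_n :=
  [set lambda *: x | x in S].

(* [is_max_value D f v] : v is the optimal value of max {f z : z in D}, that is
   the attained maximum, or -oo when D is empty.  At most one such v exists. *)
Definition is_max_value (T : Type) (D : set T) (f : T -> R) (v : \bar R) :
    Prop :=
  (D = set0 /\ v = -oo%E) \/
  (exists2 z, D z & v = (f z)%:E /\ forall z', D z' -> f z' <= f z).

End Generic.

Section Assortment.
Context {R : realType} {m n : nat}.
Context (alpha : 'I_m.+1 -> R) (r u : 'I_m.+1 -> 'I_n -> R).
(* u0 i is the no-purchase weight u_{i0}. *)
Context (u0 : 'I_m.+1 -> R) (F : 'I_m.+1 -> set 'rV[R]_n).

Definition revenue (i : 'I_m.+1) (x : 'rV[R]_n) : R :=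
  (\sum_(j < n) r i j * u i j * x 0 j) / (u0 i + \sum_(j < n) u i j * x 0 j).

Definition choice_prob_set (i : 'I_m.+1) : set (R^o * 'rV[R]_n)%type :=
  [set y : R^o * 'rV[R]_n | [/\ u0 i * y.1 + \sum_(j < n) u i j * y.2 0 j = 1,
                            dilate y.1 (F i) y.2
                          & 0 < y.1]].

Definition qap_feasible : set ('I_m.+1 -> 'rV[R]_n) :=
  [set x | (forall i, i != ord0 -> vec_le (x i) (x ord0)) /\
           (forall i, F i (x i))].

Definition qap_objective (x : 'I_m.+1 -> 'rV[R]_n) : R :=
  \sum_(i < m.+1) alpha i * revenue i (x i).

(* The variables are x_0 and the family of pairs (y_{i0}, y_i). *)
Definition rlx_feasible :
    set ('rV[R]_n * ('I_m.+1 -> R^o * 'rV[R]_n))%type :=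
  [set z : 'rV[R]_n * ('I_m.+1 -> R^o * 'rV[R]_n) |
    let: (x0, y) := z in
    [/\ forall i, i != ord0 -> conv_hull (choice_prob_set i) (y i),
        (y ord0).2 = (y ord0).1 *: x0,
        choice_prob_set ord0 (y ord0)
      & forall i, i != ord0 -> vec_le (y i).2 ((y i).1 *: x0)]].

Definition rlx_objective (z : 'rV[R]_n * ('I_m.+1 -> R^o * 'rV[R]_n)) : R :=
  \sum_(i < m.+1) alpha i * \sum_(j < n) r i j * u i j * (z.2 i).2 0 j.

End Assortment.

(* Main.v *)
Require Import Defs.
From mathcomp Require Import all_boot all_order all_algebra.
From mathcomp Require Import boolp classical_sets reals constructive_ereal convex.
From mathcomp Require Import interval_inference.

Set Implicit Arguments.
Unset Strict Implicit.
Unset Printing Implicit Defensive.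

Import Order.TTheory GRing.Theory Num.Theory.

Local Open Scope classical_set_scope.
Local Open Scope ring_scope.

(** (QAP) maximizes over finitely many families of binary vectors, so its
maximum is attained as soon as a feasible family exists.  It then suffices that
each problem dominates the other pointwise: every feasible point of one is
matched by a feasible point of the other with at least the same objective
([is_max_value_transfer]).

From (QAP) to (QAP-Rlx), an assortment [x] is sent to the unique point of
[Pi_i] on the ray through [(1, x)], its Charnes-Cooper normalization
[choice_point]; it makes the fractional revenue linear
([revenue_choice_point], [qap_lift]).

The content is in the other direction.  The constraints on type [0] force
[x_0] itself to be in [F_0], hence binary.  Where [x_0] vanishes, the constraint
[y_i <= y_{i0} x_0] and the nonnegativity of every point of [conv Pi_i] force
[y_i] to vanish.  So [y_i] lies in the face of [conv Pi_i] cut out by these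
equations, and a point of a face is a convex combination only of generators in
that face: those are the [choice_point]s of assortments [x <= x_0].  A linear
objective is at most its value at one of the generators of a convex
combination, so some feasible [x <= x_0] earns at least as much as [y_i] does
([conv_choice_dominated]).  The choices for different [i] are independent once
[x_0] is fixed, and the weights [alpha] are nonnegative, so the types can be
rounded one by one ([rlx_round]). *)

Section MaxValue.
Context {R : realType}.

Lemma is_max_value_transfer (T T' : Type) (D : set T) (D' : set T')
    (f : T -> R) (f' : T' -> R) (v : \bar R) :
    (forall z, D z -> exists2 z', D' z' & f z <= f' z') ->
    (forall z', D' z' -> exists2 z, D z & f' z' <= f z) ->
  is_max_value D f v -> is_max_value D' f' v.
Proof.
move=> DD' D'D [[D0 ->]|[z Dz [-> zmax]]].
  left; split=> //; apply/seteqP; split=> // z' /D'D[z].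
  by rewrite D0.
have [z' D'z' fz] := DD' _ Dz.
have ub w' : D' w' -> f' w' <= f z.
  by move=> /D'D[w Dw /le_trans]; apply; exact: zmax.
right; exists z' => //; split.
  by congr (_%:E); apply/le_anti; rewrite fz ub.
by move=> w' /ub /le_trans; apply.
Qed.

Lemma finite_is_max_value (T : Type) (I : finType) (e : I -> T) (D : set T)
    (f : T -> R) :
  D `<=` range e -> exists v, is_max_value D f v.
Proof.
move=> De; have [D0|/set0P[z Dz]] := eqVneq D set0.
  by exists -oo%E; left.
have [s0 _ es0] := De _ Dz.
have Ds0 : `[< D (e s0) >] by apply/asboolP; rewrite es0.
have [s /asboolP Ds smax] := @arg_maxP _ _ _ s0 (fun s => `[< D (e s) >])
  (fun s => f (e s)) Ds0.
exists (f (e s))%:E; right; exists (e s) => //; split=> // w Dw.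
have [t _ et] := De _ Dw; rewrite -et; apply: smax.
by apply/asboolP; rewrite et.
Qed.

End MaxValue.

Section Relaxation.
Context {R : realType} {m n : nat}.
Context (alpha : 'I_m.+1 -> R) (r u : 'I_m.+1 -> 'I_n -> R).
Context (u0 : 'I_m.+1 -> R) (F : 'I_m.+1 -> set 'rV[R]_n).
Hypothesis alpha_ge0 : forall i, 0 <= alpha i.
Hypothesis u_ge0 : forall i j, 0 <= u i j.
Hypothesis u0_gt0 : forall i, 0 < u0 i.
Hypothesis F_binary : forall i x, F i x -> forall j, x 0 j = 0 \/ x 0 j = 1.

Definition total_weight (i : 'I_m.+1) (x : 'rV[R]_n) : R :=
  u0 i + \sum_(j < n) u i j * x 0 j.

(** The Charnes-Cooper normalization: dividing by the total weight turns the
ratio [revenue] into the linear form [linear_revenue]. *)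
Definition choice_point (i : 'I_m.+1) (x : 'rV[R]_n) : R^o * 'rV[R]_n :=
  ((total_weight i x)^-1, (total_weight i x)^-1 *: x).

Definition linear_revenue (i : 'I_m.+1) (y : 'rV[R]_n) : R :=
  \sum_(j < n) r i j * u i j * y 0 j.

Lemma feasible_ge0 i x j : F i x -> 0 <= x 0 j.
Proof. by move=> /F_binary /(_ j)[] ->. Qed.

Lemma total_weight_gt0 i x : F i x -> 0 < total_weight i x.
Proof.
move=> Fx; rewrite ltr_wpDr// sumr_ge0// => j _.
by rewrite mulr_ge0// (feasible_ge0 _ Fx).
Qed.

Lemma linear_revenueZ i t y :
  linear_revenue i (t *: y) = t * linear_revenue i y.
Proof.
by rewrite /linear_revenue mulr_sumr; apply: eq_bigr => j _; rewrite mxE mulrCA.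
Qed.

Lemma linear_revenueD i y y' :
  linear_revenue i (y + y') = linear_revenue i y + linear_revenue i y'.
Proof.
rewrite /linear_revenue -big_split; apply: eq_bigr => j _.
by rewrite mxE mulrDr.
Qed.

Lemma revenue_choice_point i x :
  linear_revenue i (choice_point i x).2 = revenue r u u0 i x.
Proof. by rewrite linear_revenueZ mulrC. Qed.

(** The normalization constraint fixes the scale: it reads
[y_{i0} * total_weight i x = 1] for [y_i = y_{i0} x]. *)
Lemma choice_prob_setE i :
  choice_prob_set u u0 F i = [set choice_point i x | x in F i].
Proof.
have scaleE (t : R) (x : 'rV[R]_n) :
    u0 i * t + \sum_(j < n) u i j * (t *: x) 0 j = t * total_weight i x.
  rewrite mulrDr mulrC mulr_sumr; congr (_ + _).
  by apply: eq_bigr => j _; rewrite mxE mulrCA.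
apply/seteqP; split=> [[t y] /= [tw1 [x Fx xy] _]|_ [x Fx <-]].
  move: tw1; rewrite -xy scaleE /= => tw1; exists x => //.
  have w0 : total_weight i x != 0 by rewrite gt_eqF// total_weight_gt0.
  by rewrite /choice_point -[(_)^-1]mul1r -tw1 mulfK//; congr pair.
have w_gt0 := total_weight_gt0 Fx.
rewrite /choice_prob_set/=; split; last by rewrite invr_gt0.
- by rewrite scaleE mulVf// gt_eqF.
- by exists x.
Qed.

(** The face argument needs no explicit convex combination: the nonnegative
points that, if supported on [x0], earn at most the revenue of some feasible
assortment below [x0] form a convex set containing the generators. *)
Lemma conv_choice_dominated i (x0 : 'rV[R]_n) (y : R^o * 'rV[R]_n) :
    (forall j, x0 0 j = 0 \/ x0 0 j = 1) ->
    conv_hull (choice_prob_set u u0 F i) y -> vec_le y.2 (y.1 *: x0) ->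
  exists x, [/\ F i x, vec_le x x0 & linear_revenue i y.2 <= revenue r u u0 i x].
Proof.
move=> x0_binary yconv y_le.
pose C := [set y : (R^o * 'rV[R]_n)%type | (forall j, 0 <= y.2 0 j) /\
  ((forall j, x0 0 j = 0 -> y.2 0 j = 0) ->
   exists x, [/\ F i x, vec_le x x0
               & linear_revenue i y.2 <= revenue r u u0 i x])].
have CC : @convex_set _ (R^o * 'rV[R]_n)%type C.
  apply/convex_setW => a b /set_mem[a_ge0 aC] /set_mem[b_ge0 bC] k k_gt0 k_lt1.
  apply/mem_set; set t : R := k%:num in k_gt0 k_lt1.
  have t'_gt0 : 0 < 1 - t by rewrite subr_gt0.
  have convE : (conv k a b).2 = t *: a.2 + (1 - t) *: b.2 by [].
  have convj j : (conv k a b).2 0 j = t * a.2 0 j + (1 - t) * b.2 0 j.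
    by rewrite convE !mxE.
  have ta_ge0 j : 0 <= t * a.2 0 j by apply: mulr_ge0 (ltW k_gt0) (a_ge0 j).
  have tb_ge0 j : 0 <= (1 - t) * b.2 0 j.
    by apply: mulr_ge0 (ltW t'_gt0) (b_ge0 j).
  split=> [j|ab0]; first by rewrite convj addr_ge0.
  (* The face property: two nonnegative terms with positive coefficients, here
     because [0 < t < 1], sum to zero only if both vanish. *)
  have ab0j j : x0 0 j = 0 -> a.2 0 j = 0 /\ b.2 0 j = 0.
    move=> /ab0/eqP; rewrite convj paddr_eq0//.
    by rewrite !mulf_eq0 (gt_eqF k_gt0) (gt_eqF t'_gt0) => /andP[/eqP ? /eqP ?].
  have [xa [Fxa xa_le ra]] := aC (fun j j0 => (ab0j j j0).1).
  have [xb [Fxb xb_le rb]] := bC (fun j j0 => (ab0j j j0).2).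
  have rE v : revenue r u u0 i xa <= v -> revenue r u u0 i xb <= v ->
      linear_revenue i (conv k a b).2 <= v.
    move=> av bv; rewrite convE linear_revenueD !linear_revenueZ.
    have -> : v = t * v + (1 - t) * v by rewrite -mulrDl subrKC mul1r.
    by rewrite lerD// ler_pM2l//; [exact: le_trans av|exact: le_trans bv].
  have [ab|/ltW ba] := leP (revenue r u u0 i xa) (revenue r u u0 i xb).
    by exists xb; split=> //; exact: rE.
  by exists xa; split=> //; exact: rE.
have PC : choice_prob_set u u0 F i `<=` C.
  rewrite choice_prob_setE => _ [x Fx <-].
  have w_gt0 : 0 < (total_weight i x)^-1 by rewrite invr_gt0 total_weight_gt0.
  split=> [j|x_supp] /=.
    by rewrite mxE mulr_ge0 ?(ltW w_gt0)// (feasible_ge0 _ Fx).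
  exists x; split=> // [j|]; last by rewrite revenue_choice_point.
  case: (x0_binary j) => x0j.
    have /eqP := x_supp j x0j.
    by rewrite mxE mulf_eq0 gt_eqF//= => /eqP ->; rewrite x0j.
  by rewrite x0j; case: (F_binary Fx j) => ->.
have [y_ge0 yC] : C y by exact: (smallest_sub CC PC yconv).
apply: yC => j x0j; apply/le_anti; rewrite y_ge0 andbT.
by have := y_le j; rewrite mxE x0j mulr0.
Qed.

Lemma rlx_round (z : 'rV[R]_n * ('I_m.+1 -> R^o * 'rV[R]_n)) :
    rlx_feasible u u0 F z ->
  exists2 x, qap_feasible F x &
    rlx_objective alpha r u z <= qap_objective alpha r u u0 x.
Proof.
case: z => x0 y /= [yconv y0E]; rewrite choice_prob_setE => -[x0' Fx0'] y0P y_le.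
have x0E : x0' = x0.
  move: y0E; rewrite -y0P /= => /scalerI; apply.
  by rewrite invr_eq0 gt_eqF// total_weight_gt0.
subst x0'.
(* Type [0] keeps [x0] exactly, so that domination by [x0] becomes domination
   by the assortment of type [0]. *)
have ex i : exists x, [/\ F i x, vec_le x x0, i = ord0 -> x = x0
                        & linear_revenue i (y i).2 <= revenue r u u0 i x].
  have [->|i0] := eqVneq i ord0.
    exists x0; split=> //.
    by rewrite -y0P revenue_choice_point.
  have [x [Fx x_le rx]] :=
    conv_choice_dominated (F_binary Fx0') (yconv _ i0) (y_le _ i0).
  by exists x; split=> // /eqP; rewrite (negbTE i0).
have [x xP] := choice ex.
have x00 : x ord0 = x0 by case: (xP ord0) => _ _ /(_ erefl).
exists x.
  by split=> i; [rewrite x00|]; case: (xP i).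
by apply: ler_sum => i _; apply: ler_wpM2l => //; case: (xP i).
Qed.

Lemma qap_lift (x : 'I_m.+1 -> 'rV[R]_n) :
    qap_feasible F x ->
  exists2 z, rlx_feasible u u0 F z &
    qap_objective alpha r u u0 x <= rlx_objective alpha r u z.
Proof.
move=> [x_le Fx]; exists (x ord0, fun i => choice_point i (x i)).
  have Px i : choice_prob_set u u0 F i (choice_point i (x i)).
    by rewrite choice_prob_setE; exists (x i).
  split=> // i i0; first exact: sub_gen_smallest.
  move=> j; rewrite !mxE ler_wpM2l//; last exact: x_le.
  by rewrite invr_ge0 ltW// total_weight_gt0.
by apply: ler_sum => i _; rewrite -revenue_choice_point.
Qed.

(** Binary families are enumerated by the finite type of their 0/1 tables. *)
Lemma qap_is_max_value :
  exists v, is_max_value (qap_feasible F) (qap_objective alpha r u u0) v.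
Proof.
pose e (s : {ffun 'I_m.+1 * 'I_n -> bool}) i : 'rV[R]_n :=
  \row_j (s (i, j))%:R.
apply: (@finite_is_max_value _ _ _ e) => x [_ Fx].
exists [ffun ij => x ij.1 0 ij.2 == 1] => //.
apply/funext => i; apply/rowP => j; rewrite mxE ffunE /=.
by case: (F_binary (Fx i) j) => ->; rewrite ?eqxx // eq_sym oner_eq0.
Qed.

End Relaxation.

Theorem theorem1 (R : realType) (m n : nat)
    (alpha : 'I_m.+1 -> R) (r u : 'I_m.+1 -> 'I_n -> R)
    (u0 : 'I_m.+1 -> R) (F : 'I_m.+1 -> set 'rV[R]_n)
    (alpha_ge0 : forall i, 0 <= alpha i)
    (alpha_sum1 : \sum_(i < m.+1) alpha i = 1)
    (u_ge0 : forall i j, 0 <= u i j)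
    (u0_gt0 : forall i, 0 < u0 i)
    (F_binary : forall i x, F i x -> forall j, x 0 j = 0 \/ x 0 j = 1) :
  exists v : \bar R,
    is_max_value (qap_feasible F) (qap_objective alpha r u u0) v /\
    is_max_value (rlx_feasible u u0 F) (rlx_objective alpha r u) v.
Proof.
have [v vP] := qap_is_max_value alpha r u u0 F_binary.
exists v; split=> //; apply: is_max_value_transfer vP => [x|z].
  exact: qap_lift.
exact: rlx_round.
Qed.
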